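(* Let $G$ be a completely metrizable topological group with identity $e$, let $d$ be a left-invariant compatible metric on $G$, let $\rho$ be a left-invariant continuous pseudometric on $G$, and let $T\colon G\to G$ be a continuous endomorphism of $G$. Then the following assertions are equivalent: (1) $T$ admits a distributionally irregular point of type $2$; (2) $T$ admits a distributionally extremely chaotic pair of type $2$; (3) $T$ is distributionally extremely chaotic of type $2$; (4) the restriction of $T$ to some closed $T$-invariant subgroup $\widetilde{G}$ of $G$ has a dense (in $\widetilde G$) set of distributionally irregular points of type $2$.
   Context: A topological group is completely metrizable if its topology is induced by some complete metric. A compatible metric $d$ on $G$ is a metric inducing the topology of $G$ (not required to be complete). A (pseudo)metric $d$ is left-invariant if $d(zx,zy)=d(x,y)$ for all $x,y,z\in G$. A continuous endomorphism is a continuous group homomorphism $G\to G$. A subset $Y\subset G$ is $T$-invariant if $TY\subset Y$. $\mathbb{N}$ is the set of positive integers. For $A\subset\mathbb{N}$, $\overline{\mathrm{dens}}(A)=\limsup_{n\to\infty}\frac{\mathrm{card}(A\cap[1,n])}{n}$. All ''extreme'' and ''irregular'' notions are with respect to the fixed $\rho$: A point $x\in G$ is distributionally irregular of type $2$ for $T$ if there exists $A\subset\mathbb{N}$ with $\overline{\mathrm{dens}}(A)=1$ such that $\lim_{A\ni n\to\infty}T^nx=e$, and there exists $B\subset\mathbb{N}$ with $\overline{\mathrm{dens}}(B)>0$ such that $\lim_{B\ni n\to\infty}\rho(T^nx,e)=\infty$. A pair $(x,y)\in G\times G$ is distributionally proximal if for every $\varepsilon>0$, $\overline{\mathrm{dens}}(\{n\in\mathbb{N}:d(T^nx,T^ny)<\varepsilon\})=1$.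 For $\delta>0$, a pair $(x,y)$ is distributionally extremely $\delta$-chaotic of type $2$ if it is distributionally proximal and for any $M>0$, $\overline{\mathrm{dens}}(\{n\in\mathbb{N}:\rho(T^nx,T^ny)>M\})\ge\delta$. A distributionally extremely chaotic pair of type $2$ is a pair that is distributionally extremely $\delta$-chaotic of type $2$ for some $\delta>0$. $T$ is distributionally extremely chaotic of type $2$ if there exists an uncountable set $K\subset G$ such that any two distinct points $x,y\in K$ form a distributionally extremely $\delta$-chaotic pair of type $2$ for some $\delta=\delta(x,y)>0$. *)

(* Defs.v *)
From HB Require Import structures.
From mathcomp Require Import all_boot all_order all_algebra.
From mathcomp Require Import all_classical all_reals all_analysis.

Set Implicit Arguments.
Unset Strict Implicit.
Unset Printing Implicit Defensive.

Import Order.TTheory GRing.Theory Num.Theory.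
Import numFieldNormedType.Exports.

Local Open Scope classical_set_scope.
Local Open Scope ring_scope.

#[short(type="preTopologicalGroupType")]
HB.structure Definition PreTopologicalGroup :=
  {G of Topological G & Group G}.

HB.mixin Record PreTopologicalGroup_isTopologicalGroup G
    of PreTopologicalGroup G := {
  mulg_continuous : continuous (fun x : G * G => (x.1 * x.2)%g) ;
  invg_continuous : continuous (fun x : G => (x^-1)%g)
}.

#[short(type="topologicalGroupType")]
HB.structure Definition TopologicalGroup :=
  {G of PreTopologicalGroup G & PreTopologicalGroup_isTopologicalGroup G}.

Record is_pseudometric (R : realType) (X : Type) (d : X -> X -> R) : Prop :=
  IsPseudometric {
    pmetric_ge0 : forall x y, 0 <= d x y ;
    pmetric_xx : forall x, d x x = 0 ;
    pmetric_sym : forall x y, d x y = d y x ;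
    pmetric_triangle : forall y x z, d x z <= d x y + d y z }.

Definition is_metric (R : realType) (X : Type) (d : X -> X -> R) : Prop :=
  is_pseudometric d /\ forall x y, d x y = 0 -> x = y.

Definition induces_topology (R : realType) (X : topologicalType)
    (d : X -> X -> R) : Prop :=
  forall (x : X) (U : set X),
    nbhs x U <-> exists2 r : R, 0 < r & [set y | d x y < r] `<=` U.

Definition compatible_metric (R : realType) (X : topologicalType)
    (d : X -> X -> R) : Prop :=
  is_metric d /\ induces_topology d.

Definition complete_metric (R : realType) (X : Type) (d : X -> X -> R) : Prop :=
  forall u : nat -> X,
    (forall r : R, 0 < r -> exists N : nat, forall m n : nat,
       (N <= m)%N -> (N <= n)%N -> d (u m) (u n) < r) ->
    exists l : X, (fun n => d (u n) l) @ \oo --> (0 : R).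

Definition completely_metrizable (R : realType) (X : topologicalType) : Prop :=
  exists D : X -> X -> R, compatible_metric D /\ complete_metric D.

Definition left_invariant (R : realType) (G : groupType) (d : G -> G -> R) :
    Prop :=
  forall x y z : G, d (z * x)%g (z * y)%g = d x y.

(* Subsets of the positive integers are encoded as [set nat]: 0 is never
   counted, and it is irrelevant to limits along the set. The value of the
   quotient at n = 0 is irrelevant to the limsup. *)
Definition upper_density (R : realType) (A : set nat) : \bar R :=
  limn_esup (fun n : nat =>
    ((\sum_(1 <= k < n.+1) (k \in A))%N%:R / n%:R : R)%:E).

(* The base point e is explicit so that the notion applies verbatim to the
   restriction of an endomorphism to a subgroup. *)
Definition dist_irregular2 (R : realType) (X : topologicalType) (e : X)
    (rho : X -> X -> R) (T : X -> X) (x : X) : Prop :=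
  (exists A : set nat,
     upper_density R A = 1%E /\
     (fun n => iter n T x) @ within A \oo --> e) /\
  (exists B : set nat,
     (0 < upper_density R B)%E /\
     (fun n => rho (iter n T x) e) @ within B \oo --> +oo).

Definition dist_proximal (R : realType) (X : Type) (d : X -> X -> R)
    (T : X -> X) (x y : X) : Prop :=
  forall eps : R, 0 < eps ->
    upper_density R [set n | d (iter n T x) (iter n T y) < eps] = 1%E.

Definition dist_extremely_delta_chaotic2 (R : realType) (X : Type)
    (d rho : X -> X -> R) (T : X -> X) (delta : R) (x y : X) : Prop :=
  dist_proximal d T x y /\
  forall M : R, 0 < M ->
    (delta%:E <= upper_density R
                   [set n | (M < rho (iter n T x) (iter n T y))%R])%E.

Definition dist_extremely_chaotic_pair2 (R : realType) (X : Type)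
    (d rho : X -> X -> R) (T : X -> X) (x y : X) : Prop :=
  exists2 delta : R, 0 < delta &
    dist_extremely_delta_chaotic2 d rho T delta x y.

Definition dist_extremely_chaotic2 (R : realType) (X : Type)
    (d rho : X -> X -> R) (T : X -> X) : Prop :=
  exists K : set X, ~ countable K /\
    forall x y, K x -> K y -> x <> y ->
      dist_extremely_chaotic_pair2 d rho T x y.

Record closed_invariant_subgroup (G : topologicalGroupType) (T : G -> G) :=
  ClosedInvariantSubgroup {
    subgroup_set :> set G ;
    subgroup_closed : closed subgroup_set ;
    subgroup1 : subgroup_set 1%g ;
    subgroupM : forall x y,
      subgroup_set x -> subgroup_set y -> subgroup_set (x * y)%g ;
    subgroupV : forall x, subgroup_set x -> subgroup_set (x^-1)%g ;
    subgroup_invariant : T @` subgroup_set `<=` subgroup_set }.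

Definition sub_one (G : topologicalGroupType) (T : G -> G)
    (H : closed_invariant_subgroup T) : H :=
  SigSub (mem_set (subgroup1 H)).

Definition sub_endo (G : topologicalGroupType) (T : G -> G)
    (H : closed_invariant_subgroup T) : H -> H :=
  fun x => SigSub (mem_set (subgroup_invariant (imageP T (set_valP x)))).

Definition sub_dist (R : realType) (G : topologicalGroupType) (T : G -> G)
    (H : closed_invariant_subgroup T) (rho : G -> G -> R) : H -> H -> R :=
  fun x y => rho (set_val x) (set_val y).

Arguments sub_endo {G T} H.
Arguments sub_dist {R G T} H rho.

(* Main.v *)
Require Import Defs.
From HB Require Import structures.
From mathcomp Require Import all_boot all_order all_algebra.
From mathcomp Require Import all_classical all_reals all_analysis.
From mathcomp Require Import lra.

Set Implicit Arguments.
Unset Strict Implicit.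
Unset Printing Implicit Defensive.

Import Order.TTheory GRing.Theory Num.Theory.
Import numFieldNormedType.Exports.

Local Open Scope classical_set_scope.
Local Open Scope ring_scope.

(** Write |g| = d 1 g and ||g|| = rho 1 g. Left invariance makes both of them
    lengths: they are symmetric under inversion, subadditive, and
    d x y = |x^-1 y|. Hence everything about a pair (x, y) is a statement
    about the single orbit of w = x^-1 y: the pair is chaotic iff the orbit of
    w is close to 1 at times of upper density 1 and leaves every rho-ball
    around 1 at times of upper density at least some delta > 0
    ([chaotic_pairE]). An irregular point x gives the chaotic pair (1, x),
    and the whole difficulty is to go from one such w to many.

    Being often close to 1 and being often far from 1 are countable
    intersections of open conditions ([chaos_test], [open_chaos_test]), so the
    Baire category theorem applies once they are dense in a closed invariant
    subgroup H. Upper density 1 is not stable under intersection, and the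
    product of two points whose orbits approach 1 need not be such a point.
    The remedy is to fix one sequence of times n_i along which the orbit of w
    is close to 1 with frequency tending to 1: the points sharing this
    sequence form an invariant subgroup ([vanishing_along]), which contains w,
    and H is its closure. Points of that subgroup pass the tests of closeness.
    If one of them fails a test of unboundedness, multiplying it by T^k w with
    |T^k w| small moves it only slightly, and g, g T^k w cannot both be
    rarely far from 1 because T^k w is far with density delta
    ([chaotic_subgroup]).

    Points of H passing all tests are irregular, by a diagonal argument on
    decreasing sets of times ([diagonal_frequency]); they are dense in H, which
    is the last assertion. For an uncountable scrambled set take a maximal
    subset K of H whose distinct points x, y all have x^-1 y passing the tests.
    If K were countable, the translates of the tests by K would be countably
    many open dense sets, and a point in all of them would enlarge K
    ([uncountable_scrambled]). *)

(** * Frequencies and upper density *)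

Lemma natSinv_lt (R : realType) (e : R) : 0 < e ->
  exists N, forall j, (N <= j)%N -> j.+1%:R^-1 < e.
Proof. by move=> e0; have [N _ Ne] := near_infty_natSinv_lt (PosNum e0); exists N. Qed.

Section Density.
Variable R : realType.
Implicit Types (A B C : set nat) (n N : nat) (c : R).

Definition frequency A n : R :=
  (\sum_(1 <= k < n.+1) (k \in A))%N%:R / n%:R.

Lemma frequency_ge0 A n : 0 <= frequency A n.
Proof. by rewrite divr_ge0. Qed.

Lemma frequency_le1 A n : frequency A n <= 1.
Proof.
case: n => [|n]; first by rewrite /frequency invr0 mulr0.
rewrite ler_pdivrMr ?ltr0n// mul1r ler_nat.
rewrite -[leqRHS](subn1 n.+2) -[leqRHS]muln1 -sum_nat_const_nat.
by apply: leq_sum => k _; exact: leq_b1.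
Qed.

Lemma le_frequency A B n :
  (forall k, (k <= n)%N -> A k -> B k) -> frequency A n <= frequency B n.
Proof.
move=> AB; rewrite ler_wpM2r ?invr_ge0// ler_nat.
rewrite big_nat_cond [leqRHS]big_nat_cond; apply: leq_sum => k.
rewrite andbT ltnS => /andP[_ kn].
have [/set_mem /(AB _ kn) /mem_set -> //|//] := boolP (k \in A).
Qed.

Lemma frequency_subU A B C n :
  A `<=` B `|` C -> frequency A n <= frequency B n + frequency C n.
Proof.
move=> ABC; rewrite -mulrDl ler_wpM2r ?invr_ge0// -natrD ler_nat.
rewrite -big_split; apply: leq_sum => k _ /=.
have [/set_mem /ABC [] /mem_set ->|_] // := boolP (k \in A).
by rewrite addnC.
Qed.

Lemma frequencyC A n : (0 < n)%N -> frequency (~` A) n = 1 - frequency A n.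
Proof.
move=> n0; apply/eqP; rewrite eq_sym subr_eq -mulrDl -natrD -big_split /=.
rewrite (eq_bigr (fun=> 1%N)) => [|k _]; last by rewrite in_setC; case: (_ \in _).
by rewrite sum_nat_const_nat subn1 muln1 divff ?pnatr_eq0 -?lt0n.
Qed.

(** Finite sets of times are invisible to upper density: their frequency is
    O(1/n). *)
Lemma frequency_initial N n : frequency [set k | (k < N)%N] n <= N%:R / n%:R.
Proof.
rewrite ler_wpM2r ?invr_ge0// ler_nat.
have [nN|Nn] := leqP n N.
  rewrite (leq_trans _ nN)// -[leqRHS]muln1 -[X in (X * _)%N](subn1 n.+1).
  by rewrite -sum_nat_const_nat; apply: leq_sum => k _; exact: leq_b1.
rewrite (@big_cat_nat _ _ _ N.+1)//=; last exact: leqW.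
rewrite [X in (_ + X)%N]big_nat_cond [X in (_ + X)%N]big1 => [|k].
  rewrite addn0 -[leqRHS]muln1 -[X in (X * _)%N](subn1 N.+1).
  by rewrite -sum_nat_const_nat; apply: leq_sum => k _; exact: leq_b1.
rewrite andbT => /andP[Nk _]; apply/eqP; rewrite eqb0; apply/negP => /set_mem /=.
by rewrite ltnNge (ltnW Nk).
Qed.

(** Counting [A] and its shift over [1, n] uses the same times except for the
    two end points. *)
Lemma frequency_shift A n :
  `|frequency A n - frequency [set k | A k.+1] n| <= n%:R^-1.
Proof.
rewrite /frequency; have -> : (\sum_(1 <= k < n.+1) (k \in [set k | A k.+1]))%N =
    (\sum_(2 <= k < n.+2) (k \in A))%N.
  by rewrite [RHS]big_add1 /=; apply: eq_bigr => k _; congr nat_of_bool.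
rewrite -mulrBl normrM [X in _ * X]ger0_norm ?invr_ge0// ler_piMl ?invr_ge0//.
have : ((1 \in A) + \sum_(2 <= k < n.+2) (k \in A) =
        \sum_(1 <= k < n.+1) (k \in A) + (n.+1 \in A))%N.
  by rewrite -(@big_ltn _ _ _ 1 n.+2)// big_nat_recr.
move=> /(congr1 (fun k => k%:R : R)); rewrite !natrD ler_norml.
by case: (1 \in A); case: (n.+1 \in A) => /= *; apply/andP; split; lra.
Qed.

Lemma upper_densityE A :
  upper_density R A = limn_esup (fun n => (frequency A n)%:E).
Proof. by []. Qed.

Lemma upper_density_ge c A :
  (forall N, exists2 n, (N <= n)%N & c < frequency A n) ->
  (c%:E <= upper_density R A)%E.
Proof.
move=> cA; rewrite upper_densityE limn_esup_lim.
apply: lime_ge; first exact: is_cvg_esups.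
apply: nearW => N; have [n Nn cn] := cA N.
apply: (@le_trans _ _ (frequency A n)%:E); first by rewrite lee_fin ltW.
by apply: ereal_sup_ubound; exists n.
Qed.

Lemma upper_density_gt c A : (c%:E < upper_density R A)%E ->
  forall N, exists2 n, (N <= n)%N & c < frequency A n.
Proof.
move=> + N; rewrite upper_densityE => cA.
have : (c%:E < ereal_sup [set (frequency A n)%:E | n in [set n | (N <= n)%N]])%E.
  apply: (lt_le_trans cA); apply: ereal_inf_lbound.
  by exists [set n | (N <= n)%N] => //; exists N.
by move=> /ereal_sup_gt [_ [n Nn <-]]; rewrite lte_fin => ?; exists n.
Qed.

Lemma upper_density_le1 A : (upper_density R A <= 1)%E.
Proof.
rewrite leNgt; apply/negP => /upper_density_gt /(_ 0%N) [n _].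
by rewrite ltNge frequency_le1.
Qed.

Lemma upper_density_ge0 A : (0 <= upper_density R A)%E.
Proof.
rewrite upper_densityE limn_esup_lim.
apply: lime_ge; first exact: is_cvg_esups.
apply: nearW => N; apply: (@le_trans _ _ (frequency A N)%:E).
  by rewrite lee_fin frequency_ge0.
by apply: ereal_sup_ubound; exists N => /=.
Qed.

Lemma upper_density_fin_num A : upper_density R A \is a fin_num.
Proof.
rewrite ge0_fin_numE ?upper_density_ge0//.
by rewrite (le_lt_trans (upper_density_le1 A))// ltry.
Qed.

Lemma upper_density_eq1 A :
  (forall j, exists2 n, (j <= n)%N & 1 - j.+1%:R^-1 < frequency A n) ->
  upper_density R A = 1%E.
Proof.
move=> A1; apply/eqP; rewrite eq_le upper_density_le1/=.
apply/lee_addgt0Pr => e e0; rewrite -leeBlDr// -EFinB.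
apply: upper_density_ge => N; have [j je] := natSinv_lt e0.
have [n jn jc] := A1 (maxn j N).
exists n; first by rewrite (leq_trans _ jn)// leq_maxr.
by apply: lt_trans jc; rewrite ltrD2l ltrN2 je// leq_maxl.
Qed.

Lemma le_upper_density A B (C : R) :
  (forall n, frequency A n <= frequency B n + C / n%:R) ->
  (upper_density R A <= upper_density R B)%E.
Proof.
move=> AB; have bfin := upper_density_fin_num B.
rewrite -(fineK bfin); apply/lee_addgt0Pr => e e0.
rewrite leNgt; apply/negP; rewrite -EFinD => /upper_density_gt eA.
suff : ((fine (upper_density R B) + e / 2)%:E <= upper_density R B)%E.
  by rewrite -{2}(fineK bfin) lee_fin => ?; lra.
apply: upper_density_ge => N; pose K := Num.bound (2 * `|C| / e).
have [n] := eA (maxn N K.+1); rewrite geq_max => /andP[Nn Kn] An.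
exists n => //; suff : C / n%:R <= e / 2 by have := AB n; lra.
have n0 : (0 : R) < n%:R by rewrite ltr0n (leq_trans _ Kn).
have : 2 * `|C| / e < n%:R.
  have /archi_boundP/lt_le_trans : 0 <= 2 * `|C| / e.
    by rewrite divr_ge0 ?mulr_ge0// ltW.
  by apply; rewrite ler_nat ltnW.
by rewrite ltr_pdivrMr// ler_pdivrMr//; have := ler_norm C; nra.
Qed.

Lemma le_upper_density_near A B :
  (\forall k \near \oo, A k -> B k) ->
  (upper_density R A <= upper_density R B)%E.
Proof.
move=> [N _ AB]; apply: (@le_upper_density _ _ N%:R) => n.
apply: le_trans (lerD (lexx _) (frequency_initial N n)).
apply: frequency_subU => k Ak; have [Nk|kN] := leqP N k; last by right.
by left; apply: AB.
Qed.

Lemma le_upper_density_shift A :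
  (upper_density R A <= upper_density R [set k | A k.+1])%E.
Proof.
apply: (@le_upper_density _ _ 1) => n; rewrite mul1r.
by have := frequency_shift A n; rewrite ler_norml => /andP[]; lra.
Qed.

(** One set [A] does the work of all the decreasing sets [S j]: choose
    increasing times [n_ j] at which [S j] has frequency above [c j] and let
    [A] obey the constraint [S j] only after time [n_ j]. Up to time [n_ j]
    the constraints in force come from indices below [j], so they are implied
    by [S j] and [A] is at least as frequent as [S j] there. *)
Lemma diagonal_frequency (S : nat -> set nat) (c : nat -> R) :
  (forall i j, (i <= j)%N -> S j `<=` S i) ->
  (forall j N, exists2 n, (N <= n)%N & c j < frequency (S j) n) ->
  exists A : set nat,
    (forall j, exists2 n, (j <= n)%N & c j < frequency A n) /\
    (forall j, \forall k \near \oo, A k -> S j k).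
Proof.
move=> Sdec cS.
have /choice[f fP] : forall p : nat * nat, exists n,
    (p.2 <= n)%N /\ c p.1 < frequency (S p.1) n.
  by move=> [j N]; have [n] := cS j N; exists n.
pose n_ := fix n_ j := if j is i.+1 then f (j, (n_ i).+1) else f (0, 0)%N.
have n_lt : {homo n_ : i j / (i < j)%N}.
  apply: homo_ltn; first exact: ltn_trans.
  by move=> i; have [/=] := fP (i.+1, (n_ i).+1).
have n_c j : c j < frequency (S j) (n_ j).
  by case: j => [|j]; [have [] := fP (0, 0)%N|have [] := fP (j.+1, (n_ j).+1)].
exists [set k | forall j, (n_ j < k)%N -> S j k]; split=> j.
  exists (n_ j); first by elim: j => // j /leq_ltn_trans; apply; exact: n_lt.
  apply: (lt_le_trans (n_c j)); apply: le_frequency => k kn Sjk i ik.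
  apply: (Sdec i j) => //; rewrite leqNgt; apply/negP => /n_lt ji.
  by have := leq_trans ji (leq_trans (ltnW ik) kn); rewrite ltnn.
by exists (n_ j).+1 => // k /= ? /(_ j); apply.
Qed.

End Density.

(** * The Baire property of closed subsets *)

Section Baire.
Variables (R : realType) (X : topologicalType).
Hypothesis Xcm : completely_metrizable R X.

(** The usual nested balls: the state is a centre in [H] with a radius, and
    step [i] moves into [U i] while shrinking the closed ball. Working inside
    [H] avoids passing to a complete metric on the subtype. *)
Lemma Baire_closed_nat (H : set X) (U : nat -> set X) : closed H ->
  (forall i, open (U i)) -> (forall i, H `<=` closure (H `&` U i)) ->
  H `<=` closure (H `&` \bigcap_i U i).
Proof.
move=> Hcl Uop Udense x Hx O Ox.
have [D [[[[D0 Dxx Dsym Dtri] _] Dtop] Dcomplete]] := Xcm.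
have ball_nbhs y r : 0 < r -> nbhs y [set z | D y z < r].
  by move=> r0; apply/Dtop; exists r.
have ball_open y r z : D y z < r -> nbhs z [set t | D y t < r].
  move=> yz; apply/Dtop; exists (r - D y z); first by rewrite subr_gt0.
  by move=> t /= zt; have := Dtri z y t; lra.
have shrink (p : nat * (X * R)) : exists q : X * R, H p.2.1 -> 0 < p.2.2 ->
    [/\ H q.1, 0 < q.2, q.2 <= p.1.+1%:R^-1 &
        forall t, D q.1 t <= q.2 -> U p.1 t /\ D p.2.1 t <= p.2.2].
  case: p => i [y r] /=.
  have [[Hy r0]|] := pselect (H y /\ 0 < r); last by exists (y, r) => Hy r0; exfalso; auto.
  have [z [[Hz Uz] yz]] := Udense i y Hy _ (ball_nbhs _ _ r0).
  have /Dtop[s s0 sU] : nbhs z (U i `&` [set t | D y t < r]).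
    by apply: filterI; [exact: open_nbhs_nbhs|exact: ball_open].
  exists (z, Num.min (s / 2) i.+1%:R^-1) => _ _; split=> //=.
  - by rewrite lt_min divr_gt0//=.
  - by rewrite ge_min lexx orbT.
  - move=> t; rewrite le_min => /andP[zt _].
    have [|Ut yt] := sU t; first by move=> /=; lra.
    by split=> //; exact: ltW.
have [f fP] := choice shrink.
have /Dtop[r0 r0_gt0 r0O] := Ox.
pose p_ := fix p_ n := if n is i.+1 then f (i, p_ i) else (x, r0 / 2).
have pH n : H (p_ n).1 /\ 0 < (p_ n).2.
  elim: n => [/=|n [Hn rn]]; first by split=> //; rewrite divr_gt0.
  by have [] := fP (n, p_ n) Hn rn.
have pr n : (p_ n.+1).2 <= n.+1%:R^-1.
  by have [Hn rn] := pH n; have [] := fP (n, p_ n) Hn rn.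
have pU n t : D (p_ n.+1).1 t <= (p_ n.+1).2 -> U n t /\ D (p_ n).1 t <= (p_ n).2.
  by have [Hn rn] := pH n; have [_ _ _] := fP (n, p_ n) Hn rn; exact.
have nested m n t : (m <= n)%N -> D (p_ n).1 t <= (p_ n).2 -> D (p_ m).1 t <= (p_ m).2.
  by move=> /subnK <-; elim: (n - m)%N => // k IH /pU[_]; exact: IH.
have center m n : (m <= n)%N -> D (p_ m).1 (p_ n).1 <= (p_ m).2.
  by move=> mn; apply: (nested _ _ _ mn); rewrite Dxx ltW//; case: (pH n).
have [l pl] : exists l, (fun n => D (p_ n).1 l) @ \oo --> (0 : R).
  apply: Dcomplete => r r_gt0.
  have /archi_boundP Nr : 0 <= 2 / r by rewrite divr_ge0// ltW.
  exists (Num.bound (2 / r)).+1 => m n Nm Nn.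
  have := Dtri (p_ (Num.bound (2 / r)).+1).1 (p_ m).1 (p_ n).1.
  rewrite (Dsym (p_ m).1 (p_ _.+1).1); have := center _ _ Nm; have := center _ _ Nn.
  suff : (p_ (Num.bound (2 / r)).+1).2 < r / 2 by lra.
  apply: le_lt_trans (pr _) _.
  rewrite -[ltRHS]invf_div ltf_pV2 ?posrE ?divr_gt0//.
  by rewrite (lt_trans Nr)// ltr_nat.
have lball n : D (p_ n).1 l <= (p_ n).2.
  apply/ler_addgt0Pr => e e0.
  have /cvgrPdist_lt/(_ _ e0)[N _ /(_ (maxn n N))] := pl.
  move=> /(_ (leq_maxr _ _)); rewrite sub0r normrN ger0_norm// => le.
  have := Dtri (p_ (maxn n N)).1 (p_ n).1 l.
  by have := center _ _ (leq_maxl n N); lra.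
exists l; split; last first.
  by apply: r0O => /=; have := lball 0%N => /=; lra.
split; last by move=> i _; have [] := pU i l (lball i.+1).
apply: Hcl => V /Dtop[e e0 eV].
have /cvgrPdist_lt/(_ _ e0)[N _ /(_ N (leqnn N))] := pl.
rewrite sub0r normrN ger0_norm// Dsym => le.
by exists (p_ N).1; split; [case: (pH N)|exact: eV].
Qed.

Lemma Baire_closed (I : Type) (D : set I) (H : set X) (U : I -> set X) :
  countable D -> closed H -> (forall i, D i -> open (U i)) ->
  (forall i, D i -> H `<=` closure (H `&` U i)) ->
  H `<=` closure (H `&` \bigcap_(i in D) U i).
Proof.
move=> /pfcard_geP[->|[f]] Hcl Uop Udense.
  by rewrite bigcap_set0 setIT; exact: subset_closure.
have fD n : D (f n) by exact: funS.
have -> : \bigcap_(i in D) U i = \bigcap_n U (f n).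
  apply/seteqP; split=> [x Ux n _|x Ux i Di]; first exact: Ux.
  by have [n _ <-] := 'surj_f Di; exact: Ux.
by apply: Baire_closed_nat => // n; [exact: Uop|exact: Udense].
Qed.

End Baire.

(** * Lengths, iterates and visit times *)

Section Length.
Variables (R : realType) (G : groupType) (d : G -> G -> R).
Hypotheses (dpm : is_pseudometric d) (dinv : left_invariant d).

Lemma dist_length x y : d x y = d 1%g (x^-1 * y)%g.
Proof. by rewrite -(dinv _ _ x^-1%g) mulVg. Qed.

Lemma lengthV x : d 1%g x^-1%g = d 1%g x.
Proof. by rewrite (pmetric_sym dpm) dist_length invgK mulg1. Qed.

(** The triangle inequality through [x], where d x (x y) = d 1 y. *)
Lemma lengthM x y : d 1%g (x * y)%g <= d 1%g x + d 1%g y.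
Proof.
by rewrite (le_trans (pmetric_triangle dpm x _ _))// [d x _]dist_length mulKg.
Qed.

End Length.

Section Iterates.
Variables (G : groupType) (T : {multiplicative G -> G}).

Lemma iter_gmulfM n x y : iter n T (x * y)%g = (iter n T x * iter n T y)%g.
Proof. by elim: n => //= n ->; rewrite gmulfM. Qed.

Lemma iter_gmulf1 n : iter n T 1%g = 1%g.
Proof. by apply: (mulgI (iter n T 1%g)); rewrite -iter_gmulfM !mulg1. Qed.

Lemma iter_gmulfV n x : iter n T x^-1%g = (iter n T x)^-1%g.
Proof.
by apply: (mulgI (iter n T x)); rewrite -iter_gmulfM !mulgV iter_gmulf1.
Qed.

End Iterates.

Section Visits.
Variables (R : realType) (X : topologicalType) (T : X -> X).

Definition visits (V : set X) (x : X) : set nat := [set k | V (iter k T x)].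

Definition often (V : set X) (c : R) (j : nat) : set X :=
  [set x | exists2 n, (j <= n)%N & c < frequency R (visits V x) n].

Hypothesis Tcont : continuous T.

Lemma iter_continuous n : continuous (iter n T).
Proof.
elim: n => [|n IH] x; first exact: cvg_id.
exact: continuous_comp (IH x) (@Tcont _).
Qed.

(** The condition involves finitely many iterates, and visits to an open set
    persist under small perturbations of the starting point, so the frequency
    at a fixed time can only increase nearby. *)
Lemma open_often V c j : open V -> open (often V c j).
Proof.
move=> Vop; rewrite openE => x [n jn cn].
have Vnear k : \forall y \near x, visits V x k -> visits V y k.
  have [Vx|nVx] := pselect (visits V x k); last exact: nearW.
  have : nbhs x (iter k T @^-1` V).
    exact: iter_continuous (open_nbhs_nbhs (conj Vop Vx)).
  by apply: filterS => y Vy _.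
have : \forall y \near x, forall k, (k <= n)%N -> visits V x k -> visits V y k.
  elim: n {jn cn} => [|n IH].
    by apply: filterS (Vnear 0%N) => y Vy k; rewrite leqn0 => /eqP->.
  apply: filterS2 IH (Vnear n.+1) => y IH Vy k.
  by rewrite leq_eqVlt => /predU1P[->//|]; exact: IH.
apply: filterS => y Vxy; exists n => //.
exact: (lt_le_trans cn (le_frequency _ Vxy)).
Qed.

End Visits.

(** * Closures and translates *)

Lemma closure_preserved (X : topologicalType) (A : set X) (f : X -> X) :
  continuous f -> (forall x, A x -> A (f x)) -> forall x, closure A x -> closure A (f x).
Proof.
move=> fc Af x Ax B /fc /Ax[y [Ay By]].
by exists (f y); split=> //; exact: Af.
Qed.

Lemma closure_mulg (G : topologicalGroupType) (A : set G) :
  (forall x y, A x -> A y -> A (x * y)%g) ->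
  forall x y, closure A x -> closure A y -> closure A (x * y)%g.
Proof.
move=> AM x y Ax Ay B Bxy.
have [[P Q] /= [Px Qy] PQB] := @mulg_continuous G (x, y) B Bxy.
have [p [Ap Pp]] := Ax _ Px; have [q [Aq Qq]] := Ay _ Qy.
by exists (p * q)%g; split; [exact: AM|exact: (PQB (p, q))].
Qed.

Lemma open_ltrans (G : topologicalGroupType) (U : set G) (y : G) :
  open U -> open [set x | U (y^-1 * x)%g].
Proof.
move=> Uop; apply: (@open_comp _ _ (fun x => y^-1 * x)%g U) => // x _.
apply: (@continuous_comp _ _ _ (fun x : G => (y^-1%g, x)) (fun p => p.1 * p.2)%g).
  by apply: cvg_pair; [exact: cvg_cst|exact: cvg_id].
exact: mulg_continuous.
Qed.

(** * Open tests for irregularity *)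

Section Chaos.
Variables (R : realType) (G : topologicalGroupType) (d rho : G -> G -> R).
Variable T : {multiplicative G -> G}.
Hypotheses (dcompat : compatible_metric d) (dinv : left_invariant d).
Hypotheses (rhopm : is_pseudometric rho) (rhoinv : left_invariant rho).
Hypothesis rhocont : continuous (fun p : G * G => rho p.1 p.2).
Hypothesis Tcont : continuous T.

Let dpm : is_pseudometric d := dcompat.1.1.
Let dtop : induces_topology d := dcompat.2.

Definition near_one (j : nat) : set G := [set g | d 1%g g < j.+1%:R^-1].
Definition far (j : nat) : set G := [set g | j%:R < rho 1%g g].

(** The index [j] is at once the precision, the frequency defect and the
    earliest admissible time. This loses nothing, because passing the tests of
    all larger indices gives every combination of the three
    ([chaos_test_near], [chaos_test_far]). *)
Definition chaos_test (c : R) (i : nat + nat) : set G :=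
  match i with
  | inl j => often T (near_one j) (1 - j.+1%:R^-1 : R) j
  | inr j => often T (far j) c j
  end.

Definition proximal_to_one (w : G) := forall eps : R, 0 < eps ->
  upper_density R (visits T [set g | d 1%g g < eps] w) = 1%E.
Definition unbounded (c : R) (w : G) := forall M : R, 0 < M ->
  (c%:E <= upper_density R (visits T [set g | (M < rho 1%g g)%R] w))%E.

(** The iterates are endomorphisms, so d (T^n x) (T^n y) = |T^n (x^-1 y)|. *)
Lemma chaotic_pairE x y : dist_extremely_chaotic_pair2 d rho T x y <->
  exists2 delta, 0 < delta &
    proximal_to_one (x^-1 * y)%g /\ unbounded delta (x^-1 * y)%g.
Proof.
have E (f : G -> G -> R) (S : set R) : left_invariant f ->
    [set n | S (f (iter n T x) (iter n T y))] =
    visits T [set g | S (f 1%g g)] (x^-1 * y)%g.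
  move=> finv; apply/seteqP; split=> n;
  by rewrite /visits /= iter_gmulfM iter_gmulfV -dist_length.
have dE e := E d [set r | r < e] dinv.
have rhoE M := E rho [set r | M < r] rhoinv.
split=> -[delta delta0 [prox unb]]; exists delta; try exact: delta0.
  split=> [e e0|M M0]; first by rewrite -(prox e e0) -dE.
  by rewrite -rhoE; exact: unb.
split=> [e e0|M M0]; first by rewrite -(prox e e0) -dE.
by move: (unb M M0); rewrite -rhoE.
Qed.

Lemma near_oneS i j : (i <= j)%N -> near_one j `<=` near_one i.
Proof.
move=> ij g /= /lt_le_trans; apply.
by rewrite lef_pV2 ?posrE// ler_nat ltnS.
Qed.

Lemma farS i j : (i <= j)%N -> far j `<=` far i.
Proof. by move=> ij g; apply: le_lt_trans; rewrite ler_nat. Qed.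

Lemma visitsS (U V : set G) x : U `<=` V -> visits T U x `<=` visits T V x.
Proof. by move=> UV k; exact: UV. Qed.

Lemma oftenS (U V : set G) (b c : R) i j : U `<=` V -> b <= c -> (i <= j)%N ->
  often T U c j `<=` often T V b i.
Proof.
move=> UV bc ij x [n jn cn]; exists n; first exact: leq_trans jn.
rewrite (le_lt_trans bc)// (lt_le_trans cn)//.
by apply: le_frequency => k _; exact: visitsS.
Qed.

Lemma chaos_test_near c x : (forall i, chaos_test c i x) ->
  forall j N, often T (near_one j) (1 - j.+1%:R^-1 : R) N x.
Proof.
move=> cx j N; have := cx (inl (maxn j N)); apply: oftenS.
- by apply: near_oneS; exact: leq_maxl.
- by rewrite lerB// lef_pV2 ?posrE// ler_nat ltnS leq_maxl.
- exact: leq_maxr.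
Qed.

Lemma chaos_test_far c x : (forall i, chaos_test c i x) ->
  forall j N, often T (far j) c N x.
Proof.
move=> cx j N; have := cx (inr (maxn j N)); apply: oftenS => //.
- by apply: farS; exact: leq_maxl.
- exact: leq_maxr.
Qed.

Lemma chaos_test_sequences c x : (forall i, chaos_test c i x) ->
  (exists A : set nat, upper_density R A = 1%E /\
     forall j, \forall k \near \oo, A k -> near_one j (iter k T x)) /\
  (exists B : set nat, (c%:E <= upper_density R B)%E /\
     forall j, \forall k \near \oo, B k -> far j (iter k T x)).
Proof.
move=> cx; split.
  have [|//|A [Afreq AS]] := diagonal_frequency (S := fun j => visits T (near_one j) x)
      (c := fun j => 1 - j.+1%:R^-1 : R).
  - by move=> i j ij; apply: visitsS; exact: near_oneS.
  - by move=> j N; have [n] := chaos_test_near cx j N; exists n.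
  - by exists A; split=> //; exact: upper_density_eq1.
have [|//|B [Bfreq BS]] := diagonal_frequency (S := fun j => visits T (far j) x)
    (c := fun=> c).
- by move=> i j ij; apply: visitsS; exact: farS.
- by move=> j N; have [n] := chaos_test_far cx j N; exists n.
- by exists B; split=> //; exact: upper_density_ge.
Qed.

Lemma chaos_test_proximal c x : (forall i, chaos_test c i x) -> proximal_to_one x.
Proof.
move=> /chaos_test_sequences[[A [A1 Ax]] _] e e0.
apply/eqP; rewrite eq_le upper_density_le1 -A1 /=; apply: le_upper_density_near.
have [j /(_ j (leqnn _)) je] := natSinv_lt e0.
by apply: filterS (Ax j) => k Axk /Axk /lt_trans; apply.
Qed.

Lemma chaos_test_unbounded c x : (forall i, chaos_test c i x) -> unbounded c x.
Proof.
move=> /chaos_test_sequences[_ [B [cB Bx]]] M M0; apply: le_trans cB _.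
apply: le_upper_density_near; apply: filterS (Bx (Num.bound M)) => k Bxk /Bxk.
by apply: le_lt_trans; rewrite ltW// archi_boundP// ltW.
Qed.

(** This symmetry makes the relation between [x] and [y] that [x^-1 * y] passes
    the tests symmetric, as needed for scrambled sets. *)
Lemma chaos_testV c i x : chaos_test c i x^-1%g <-> chaos_test c i x.
Proof.
have E V : (forall g, V g^-1%g <-> V g) -> visits T V x^-1%g = visits T V x.
  by move=> VV; apply/seteqP; split=> k /=; rewrite /visits /= iter_gmulfV => /VV.
case: i => j /=; rewrite /often /= E//.
- by move=> g; rewrite /near_one /= lengthV.
- by move=> g; rewrite /far /= lengthV.
Qed.

(** Consequently a point [x] such that [y^-1 * x] passes the tests for all [y]
    in a set [K] is a new point: taking y = x would let 1 pass. *)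
Lemma not_chaos_test1 c : 0 <= c -> ~ chaos_test c (inr 0%N) 1%g.
Proof.
move=> c0 [n _]; apply/negP; rewrite -leNgt.
have -> : visits T (far 0) 1%g = [set k | (k < 0)%N].
  by apply/seteqP; split=> // k; rewrite /visits /far /= iter_gmulf1 (pmetric_xx rhopm) ltxx.
by rewrite (le_trans (frequency_initial _ _ _))// mul0r.
Qed.

Lemma open_near_one j : open (near_one j).
Proof.
rewrite openE => g /= gj; apply/dtop; exists (j.+1%:R^-1 - d 1%g g).
  by rewrite subr_gt0.
move=> h /=; rewrite ltrBrDl; apply: le_lt_trans.
exact: (pmetric_triangle dpm).
Qed.

Lemma open_far j : open (far j).
Proof.
apply: (@open_comp _ _ (fun g => rho 1%g g) [set r | j%:R < r]); last exact: open_gt.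
move=> g _; apply: (@continuous_comp _ _ _ (fun g : G => (1%g : G, g)) (fun p => rho p.1 p.2)).
  by apply: cvg_pair; [exact: cvg_cst|exact: cvg_id].
exact: rhocont.
Qed.

Lemma open_chaos_test c i : open (chaos_test c i).
Proof.
by case: i => j; apply: open_often => //; [exact: open_near_one|exact: open_far].
Qed.

(** * The closed invariant subgroup carried by a chaotic pair *)

(** The same times [n_] serve all points and all [eps]. This makes the set
    stable under products, in contrast with proximality to 1, where each point
    has good times of its own. *)
Definition vanishing_along (n_ : nat -> nat) : set G :=
  [set g | forall eps eta : R, 0 < eps -> 0 < eta -> \forall i \near \oo,
     frequency R (visits T [set h | eps <= d 1%g h] g) (n_ i) < eta].

Section Vanishing.
Variable n_ : nat -> nat.
Hypothesis n_gt : forall i, (i < n_ i)%N.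

Lemma vanishing_along1 : vanishing_along n_ 1%g.
Proof.
move=> e eta e0 eta0; apply: nearW => i; apply: le_lt_trans eta0.
have -> : visits T [set h | e <= d 1%g h] 1%g = [set k | (k < 0)%N].
  apply/seteqP; split=> // k; rewrite /visits /= iter_gmulf1 (pmetric_xx dpm).
  by rewrite leNgt e0.
by rewrite (le_trans (frequency_initial _ _ _))// mul0r.
Qed.

Lemma vanishing_alongM x y : vanishing_along n_ x -> vanishing_along n_ y ->
  vanishing_along n_ (x * y)%g.
Proof.
move=> Vx Vy e eta e0 eta0.
have e20 : 0 < e / 2 by lra.
have eta20 : 0 < eta / 2 by lra.
apply: filterS2 (Vx _ _ e20 eta20) (Vy _ _ e20 eta20) => i xi yi.
rewrite [ltRHS]splitr; apply: le_lt_trans (ltrD xi yi).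
apply: frequency_subU => k; rewrite /visits /= iter_gmulfM => exy.
have := le_trans exy (lengthM dpm dinv _ _).
have [xe|xe _] := ltP (d 1%g (iter k T x)) (e / 2); last by left.
by move=> ?; right => /=; lra.
Qed.

Lemma vanishing_alongV x : vanishing_along n_ x -> vanishing_along n_ x^-1%g.
Proof.
move=> Vx e eta e0 eta0; apply: filterS (Vx e eta e0 eta0) => i.
apply: le_lt_trans; apply: le_frequency => k _.
by rewrite /visits /= iter_gmulfV lengthV.
Qed.

Lemma vanishing_alongT x : vanishing_along n_ x -> vanishing_along n_ (T x).
Proof.
move=> Vx e eta e0 eta0; have eta20 : 0 < eta / 2 by lra.
have [N Ninv] := natSinv_lt eta20.
near=> i; set V := [set h | _].
have -> : visits T V (T x) = [set k | visits T V x k.+1].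
  by apply/seteqP; split=> k; rewrite /visits /= -iterSr.
have : frequency R (visits T V x) (n_ i) < eta / 2 by near: i; exact: Vx.
have : (n_ i)%:R^-1 < eta / 2.
  have Ni : (N < n_ i)%N.
    by rewrite (leq_ltn_trans _ (n_gt i))//; near: i; exists N.
  by rewrite -(prednK (leq_ltn_trans (leq0n _) Ni)) Ninv// -ltnS (ltn_predK Ni).
have := frequency_shift R (visits T V x) (n_ i); rewrite ler_norml => /andP[].
by lra.
Unshelve. all: by end_near. Qed.

Lemma vanishing_along_often x j : vanishing_along n_ x ->
  often T (near_one j) (1 - j.+1%:R^-1 : R) j x.
Proof.
move=> Vx; have j0 : 0 < j.+1%:R^-1 :> R by [].
have [N _ /(_ (maxn N j) (leq_maxl _ _)) Nj] := Vx _ _ j0 j0.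
exists (n_ (maxn N j)); first by rewrite (leq_trans (leq_maxr N j))// ltnW.
rewrite ltrBlDr -ltrBlDl; apply: le_lt_trans Nj.
rewrite -frequencyC; last exact: leq_ltn_trans (n_gt _).
by apply: le_frequency => k _ /= /negP; rewrite -leNgt.
Qed.

End Vanishing.

(** Upper density 1 for each precision [i.+1%:R^-1] yields a time [n_ i] where
    the frequency defect is below the same quantity. *)
Lemma proximal_vanishing_along w : proximal_to_one w ->
  exists2 n_ : nat -> nat, (forall i, (i < n_ i)%N) & vanishing_along n_ w.
Proof.
move=> wprox; have : forall i, exists n, (i < n)%N /\
    1 - i.+1%:R^-1 < frequency R (visits T (near_one i) w) n.
  move=> i; have wi : ((1 - i.+1%:R^-1)%:E < upper_density R (visits T (near_one i) w))%E.
    by rewrite wprox// lte_fin ltrBlDr ltrDl.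
  by have [n] := upper_density_gt wi i.+1; exists n.
move=> /choice[n_ nP]; exists n_ => [i|e eta e0 eta0]; first by case: (nP i).
have [N1 N1e] := natSinv_lt e0; have [N2 N2eta] := natSinv_lt eta0.
exists (maxn N1 N2) => // i /=; rewrite geq_max => /andP[/N1e ie /N2eta].
apply: le_lt_trans; have [ni /ltW] := nP i.
rewrite lerBlDr -lerBlDl; apply: le_trans.
rewrite -frequencyC; last exact: leq_ltn_trans ni.
apply: le_frequency => k _; rewrite /visits /near_one /= => ek /lt_trans /(_ ie).
by rewrite ltNge ek.
Qed.

Lemma unbounded_iter c w n : unbounded c w -> unbounded c (iter n T w).
Proof.
move=> wc; elim: n => //= n IH M M0; apply: le_trans (IH M M0) _.
apply: le_trans (le_upper_density_shift _ _) _.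
by apply: le_upper_density_near; apply: nearW => k; rewrite /visits /= -iterSr.
Qed.

Lemma proximal_return w r : proximal_to_one w -> 0 < r ->
  exists k, d 1%g (iter k T w) < r.
Proof.
move=> wprox r0.
have w1 : (0%:E < upper_density R (visits T [set g | (d 1%g g < r)%R] w))%E.
  by rewrite wprox// lte_fin.
have [n _ n0] := upper_density_gt w1 0%N; apply: contrapT => nok.
suff : frequency R (visits T [set g | d 1%g g < r] w) n <= 0.
  by rewrite leNgt n0.
rewrite -(mul0r n%:R^-1) (le_trans _ (frequency_initial R 0 n))//.
by apply: le_frequency => k _ wk; exfalso; apply: nok; exists k.
Qed.

(** Where [u] is far from 1, subadditivity applied to u = g^-1 (g u) shows that
    [g] or [g * u] is half as far. So if the visits of [u] have frequency above
    2c/3 up to some time, those of one of the two have frequency above c/3 up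
    to that time. *)
Lemma unbounded_often c g u j : 0 < c -> unbounded c u ->
  often T (far j) (c / 3) j g \/ often T (far j) (c / 3) j (g * u)%g.
Proof.
(* The threshold is 2 (j + 1) rather than 2 j because unboundedness speaks
   only of positive thresholds, and j may be 0. *)
move=> c0 /(_ (2 * j.+1%:R)) => uc.
have /upper_density_gt/(_ j)[n jn cn] :
    ((2 * c / 3)%:E <
      upper_density R (visits T [set h | (2 * j.+1%:R < rho 1%g h)%R] u))%E.
  by apply: lt_le_trans (uc _); rewrite ?lte_fin ?mulr_gt0//; lra.
have : visits T [set h | 2 * j.+1%:R < rho 1%g h] u `<=`
    visits T (far j) g `|` visits T (far j) (g * u)%g.
  move=> k; rewrite /visits /far /= => uk.
  have [gk|] := ltP j%:R (rho 1%g (iter k T g)); first by left.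
  have := lengthM rhopm rhoinv (iter k T g)^-1%g (iter k T (g * u)%g).
  rewrite lengthV// iter_gmulfM mulKg => le_u gk; right.
  by move: uk => /=; rewrite -natr1; lra.
move=> /(frequency_subU R n) gun.
have [gn|gn] := ltP (c / 3) (frequency R (visits T (far j) g) n).
  by left; exists n.
by right; exists n => //; lra.
Qed.

(** Density of the tests holds already on the subgroup of which [H] is the
    closure: closeness is automatic there, and unboundedness is obtained after
    a right translation by a small iterate of [w]. Left invariance of [d] makes
    that translation a small move. *)
Lemma chaotic_subgroup delta w : 0 < delta ->
  proximal_to_one w -> unbounded delta w ->
  exists H : closed_invariant_subgroup T, forall i,
    H `<=` closure (H `&` chaos_test (delta / 3) i).
Proof.
move=> delta0 wprox wunb; have [n_ n_gt Vw] := proximal_vanishing_along wprox.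
have VT k : vanishing_along n_ (iter k T w).
  by elim: k => //= k; exact: vanishing_alongT.
have inv : T @` closure (vanishing_along n_) `<=` closure (vanishing_along n_).
  by move=> _ [x Vx <-]; apply: closure_preserved Vx => //; exact: vanishing_alongT.
pose H := @ClosedInvariantSubgroup G T (closure (vanishing_along n_)) (@closed_closure _ _)
  (subset_closure (@vanishing_along1 n_)) (closure_mulg (@vanishing_alongM n_))
  (closure_preserved (@invg_continuous G) (@vanishing_alongV n_)) inv.
exists H; case=> j x Hx O /nbhs_interior/Hx[g [Vg Og]].
  exists g; split; last exact: interior_subset.
  by split; [exact: subset_closure|exact: vanishing_along_often].
have [r r0 rO] := (dtop g O).1 Og.
have [k kr] := proximal_return wprox r0.
have [gj|gj] := unbounded_often g j delta0 (@unbounded_iter _ _ k wunb).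
  exists g; split; last exact: interior_subset.
  by split=> //; exact: subset_closure.
exists (g * iter k T w)%g; split; last first.
  by apply: rO; rewrite /= (dist_length dinv) mulKg.
by split=> //; apply: subset_closure; exact: vanishing_alongM.
Qed.

(** * Scrambled sets and dense irregular points *)

Lemma dense_ltrans (H : closed_invariant_subgroup T) (U : set G) y :
  subgroup_set H y ->
  H `<=` closure (H `&` U) -> H `<=` closure (H `&` [set x | U (y^-1 * x)%g]).
Proof.
move=> Hy HU x Hx O Ox.
have Hyx : subgroup_set H (y^-1 * x)%g by apply: subgroupM => //; exact: subgroupV.
have [|z [[Hz Uz] Oz]] := HU _ Hyx [set z | O (y * z)%g].
  have := @mulg_continuous G (y, y^-1 * x)%g O.
  rewrite /= mulVKg => /(_ Ox)[[P Q] /= [Py Qx] PQO].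
  apply: filterS Qx => z Qz; apply: (PQO (y, z)); split=> //=.
  exact: nbhs_singleton.
exists (y * z)%g; split=> //; split; first exact: subgroupM.
by rewrite /= mulKg.
Qed.

(** Maximality replaces an explicit construction of a Cantor set: a countable
    scrambled set can always be extended, by Baire applied to the translates
    of the tests by its points. When it is empty, any point of [H] extends
    it. *)
Lemma uncountable_scrambled (H : closed_invariant_subgroup T) c :
  completely_metrizable R G -> 0 <= c ->
  (forall i, H `<=` closure (H `&` chaos_test c i)) ->
  exists2 K : set G, ~ countable K &
    forall x y, K x -> K y -> x <> y -> forall i, chaos_test c i (x^-1 * y)%g.
Proof.
move=> Gcm c0 Hdense.
pose scrambled (K : set G) := K `<=` H /\
  forall x y, K x -> K y -> x <> y -> forall i, chaos_test c i (x^-1 * y)%g.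
have [F Fscr Ftot|K [[KH Kscr] Kmax]] := @Zorn_bigcup G scrambled.
  split=> [x [K /Fscr[KH _] /KH]//|x y [K FK Kx] [L FL Ly]].
  have [KL|LK] := Ftot _ _ FK FL.
    by apply: (Fscr _ FL).2 => //; exact: KL.
  by apply: (Fscr _ FK).2 => //; exact: LK.
exists K => // Kcount.
pose U (p : G * (nat + nat)) := [set x | chaos_test c p.2 (p.1^-1 * x)%g].
have : H `<=` closure (H `&` \bigcap_(p in K `*` setT) U p).
  apply: (Baire_closed Gcm); first exact: countableX.
  - exact: subgroup_closed.
  - by move=> [y i] _; apply: open_ltrans; exact: open_chaos_test.
  - by move=> [y i] [/= /KH Hy _]; exact: dense_ltrans.
move=> /(_ 1%g (subgroup1 H) setT filterT)[x [[Hx xU] _]].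
have xK i y : K y -> chaos_test c i (y^-1 * x)%g by move=> Ky; exact: (xU (y, i)).
have nKx : ~ K x.
  by move=> /(xK (inr 0%N)); rewrite mulVg; exact: not_chaos_test1.
apply: (Kmax (x |` K)).
  by split=> [y|/(_ x)]; [right|move=> xKK; apply: nKx; apply: xKK; left].
split=> [y [->//|/KH//]|y z].
case=> [->|Ky]; case=> [->//|Kz] yz i.
- by apply: (chaos_testV _ _ _).1; rewrite invgM invgK; exact: xK.
- exact: xK.
- exact: Kscr.
Qed.

Lemma irregular_chaotic x : dist_irregular2 1%g rho T x ->
  exists2 delta, 0 < delta & proximal_to_one x /\ unbounded delta x.
Proof.
move=> [[A [A1 Ax]] [B [B0 Bx]]].
have Bfin := upper_density_fin_num R B.
exists (fine (upper_density R B)); first by rewrite -lte_fin fineK.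
split=> [e e0|M M0].
  apply/eqP; rewrite eq_le upper_density_le1 -A1 /=; apply: le_upper_density_near.
  have /Ax// : nbhs (1%g : G) [set g | d 1%g g < e] by apply/dtop; exists e.
rewrite fineK//; apply: le_upper_density_near.
have /cvgryPgt/(_ M) := Bx.
by apply: filterS => n; rewrite (pmetric_sym rhopm).
Qed.

Lemma val_iter_sub_endo (H : closed_invariant_subgroup T) n (x : H) :
  set_val (iter n (sub_endo H) x) = iter n T (set_val x).
Proof. by elim: n => //= n <-. Qed.

Lemma sub_irregular (H : closed_invariant_subgroup T) (x : H) :
  dist_irregular2 (sub_one H) (sub_dist H rho) (sub_endo H) x ->
  dist_irregular2 1%g rho T (set_val x).
Proof.
move=> [[A [A1 Ax]] [B [B0 Bx]]]; split.
  exists A; split=> //.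
  under eq_fun do rewrite -val_iter_sub_endo.
  exact: (continuous_cvg _ (@initial_continuous _ _ set_val (sub_one H)) Ax).
exists B; split=> //; under eq_fun do rewrite -val_iter_sub_endo.
exact: Bx.
Qed.

(** Passing all the tests is stated in [G]; as the topology of [H] is induced,
    the two sequences of times obtained there also serve in [H]. *)
Lemma chaos_test_irregular (H : closed_invariant_subgroup T) c (x : H) :
  0 < c -> (forall i, chaos_test c i (set_val x)) ->
  dist_irregular2 (sub_one H) (sub_dist H rho) (sub_endo H) x.
Proof.
move=> c0 /chaos_test_sequences[[A [A1 Ax]] [B [B1 Bx]]]; split.
  exists A; split=> // O [_ [[V Vop <-] V1 VO]].
  have /dtop[r r0 rV] : nbhs 1%g V by exact: open_nbhs_nbhs.
  have [j /(_ j (leqnn _)) jr] := natSinv_lt r0.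
  apply: filterS (Ax j) => k Axk Ak; apply: VO; apply: rV.
  by rewrite /= val_iter_sub_endo (lt_trans _ jr)//; exact: Axk.
exists B; split; first by apply: lt_le_trans B1; rewrite lte_fin.
apply/cvgryPgt => M; apply: filterS (Bx (Num.bound `|M|)) => k Bxk Bk.
rewrite /sub_dist val_iter_sub_endo (pmetric_sym rhopm).
apply: le_lt_trans (Bxk Bk); apply: le_trans (ler_norm M) _.
by rewrite ltW// archi_boundP.
Qed.

Lemma dense_irregular (H : closed_invariant_subgroup T) c :
  completely_metrizable R G -> 0 < c ->
  (forall i, H `<=` closure (H `&` chaos_test c i)) ->
  dense [set x : H |
    dist_irregular2 (sub_one H) (sub_dist H rho) (sub_endo H) x].
Proof.
move=> Gcm c0 Hdense O [x +] [V Vop VO]; rewrite -{O}VO => Vx.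
have : H `<=` closure (H `&` \bigcap_i chaos_test c i).
  apply: (Baire_closed Gcm) => //; first exact: subgroup_closed.
  by move=> i _; exact: open_chaos_test.
move=> /(_ _ (set_valP x) V (open_nbhs_nbhs (conj Vop Vx)))[y [[Hy yw] Vy]].
exists (SigSub (mem_set Hy) : H); split=> //.
by apply: (@chaos_test_irregular _ c) => // i; exact: yw.
Qed.

End Chaos.

(** * The equivalence *)

Theorem theorem5p27 (R : realType) (G : topologicalGroupType)
    (d rho : G -> G -> R) (T : {multiplicative G -> G})
    (Gcm : completely_metrizable R G)
    (dcompat : compatible_metric d) (dinv : left_invariant d)
    (rhopm : is_pseudometric rho)
    (rhocont : continuous (fun p : G * G => rho p.1 p.2))
    (rhoinv : left_invariant rho)
    (Tcont : continuous T) :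
  [<-> exists x : G, dist_irregular2 1%g rho T x;
       exists x y : G, dist_extremely_chaotic_pair2 d rho T x y;
       dist_extremely_chaotic2 d rho T;
       exists H : closed_invariant_subgroup T,
         dense [set x : H |
           dist_irregular2 (sub_one H) (sub_dist H rho) (sub_endo H) x]].
Proof.
have pairP x y := @chaotic_pairE R G d rho T dinv rhoinv x y.
tfae.
- move=> [x /(irregular_chaotic dcompat rhopm) xT]; exists 1%g, x.
  by apply/pairP; rewrite invg1 mul1g.
- move=> [x [y /pairP[delta delta0 [prox unb]]]].
  have [H Hdense] := chaotic_subgroup dcompat dinv rhopm rhoinv Tcont delta0 prox unb.
  have c0 : 0 < delta / 3 by rewrite divr_gt0.
  have [K Kunc Kscr] := uncountable_scrambled dcompat dinv rhopm rhoinv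
    rhocont Tcont Gcm (ltW c0) Hdense.
  exists K; split=> // u v Ku Kv uv; have uvw := Kscr u v Ku Kv uv.
  apply/pairP; exists (delta / 3) => //.
  by split; [exact: chaos_test_proximal uvw|exact: chaos_test_unbounded uvw].
- move=> [K [Kunc Kpair]].
  have [x [y [Kx [Ky xy]]]] : exists x y, K x /\ K y /\ x <> y.
    apply: contrapT => K1; apply: Kunc.
    have [->//|/set0P[x Kx]] := eqVneq K set0.
    apply: (sub_countable _ (countable1 x)); apply: subset_card_le => y Ky /=.
    by apply: contrapT => yx; apply: K1; exists y, x.
  have /pairP[delta delta0 [prox unb]] := Kpair x y Kx Ky xy.
  have [H Hdense] := chaotic_subgroup dcompat dinv rhopm rhoinv Tcont delta0 prox unb.
  exists H; apply: dense_irregular Hdense => //.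
  by rewrite divr_gt0.
- move=> [H /(_ setT)[]]; first by exists (sub_one H).
    exact: openT.
  by move=> x [_ /sub_irregular]; exists (set_val x).
Qed.
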